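(* Let $\epsilon=(\alpha,\beta,\gamma)$ be a one-face embedding of a graph $G$ (i.e. $\gamma=\alpha\beta$ is a single cycle), and let $\nu$ be a vertex of $G$ with $deg(\nu)\geq 4$. Then there exists at least one reembedding $\beta'\neq\beta$ of $\nu$ such that the resulting embedding $\epsilon'=(\alpha,\beta',\alpha\beta')$ has the same genus as $\epsilon$.
   Context: A map (embedding of a graph on a closed orientable surface) with $m$ edges is a triple $(\alpha,\beta,\gamma)$ of permutations of $[2m]$ (elements are half-edges) where $\alpha$ is a fixed-point-free involution whose cycles are the edges, the cycles of $\beta$ give the counterclockwise cyclic order of half-edges at each vertex, and $\gamma=\alpha\beta$ (composition), whose cycles are the faces. Its genus $g$ is defined by $C(\beta)-C(\alpha)+C(\gamma)=2-2g$, where $C(\cdot)$ is the number of cycles. The underlying graph is $G=(\alpha,Par_\beta)$, $Par_\beta$ being the partition of $[2m]$ into cycles of $\beta$; its blocks are the vertices, and $deg(\nu)=|\nu|$. An embedding of $G$ is any map $(\alpha,\beta',\alpha\beta')$ with $Par_{\beta'}=Par_\beta$. A reembedding of the vertex $\nu$ is a permutation $\beta'$ with $\beta'(x)=\beta(x)$ for $x\notin\nu$ and $\beta'$ restricted to $\nu$ a single cycle on $\nu$. *)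

(* Defs.v *)
From HB Require Import structures.
From mathcomp Require Import all_boot all_order all_algebra all_fingroup.

Set Implicit Arguments.
Unset Strict Implicit.
Unset Printing Implicit Defensive.

Import GRing.Theory.

Local Open Scope ring_scope.

(* Products of permutations are composed from right to left, so that
   [alpha beta] sends [x] to [alpha (beta x)]; MathComp's group law on
   permutations applies its left factor first, hence the swap. *)
Definition perm_comp (T : finType) (a b : {perm T}) : {perm T} := (b * a)%g.

Lemma perm_compE (T : finType) (a b : {perm T}) (x : T) :
  perm_comp a b x = a (b x).
Proof. exact: permM. Qed.

Definition fixfree_involution (T : finType) (a : {perm T}) : Prop :=
  (forall x, a (a x) = x) /\ (forall x, a x <> x).

Definition ncycles (T : finType) (s : {perm T}) : nat := #|porbits s|.

(* Connectedness is not required. *)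
Record cmap (m : nat) := Cmap {
  alpha : {perm 'I_(2 * m)};
  beta : {perm 'I_(2 * m)};
  gamma : {perm 'I_(2 * m)};
  alpha_edges : fixfree_involution alpha;
  gammaE : gamma = perm_comp alpha beta
}.

(* Half-edges, paired into edges by an involution and grouped into vertices
   by a partition; loops and multiple edges are allowed. *)
Record graph (m : nat) := Graph {
  edge_inv : {perm 'I_(2 * m)};
  vertices : {set {set 'I_(2 * m)}};
  edge_invP : fixfree_involution edge_inv;
  verticesP : partition vertices [set: 'I_(2 * m)]
}.

Definition deg (m : nat) (nu : {set 'I_(2 * m)}) : nat := #|nu|.

Definition is_embedding (m : nat) (eps : cmap m) (G : graph m) : Prop :=
  alpha eps = edge_inv G /\ porbits (beta eps) = vertices G.

Definition one_face (m : nat) (eps : cmap m) : Prop := ncycles (gamma eps) = 1%N.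

(* The rational solution [g] of [C(beta) - C(alpha) + C(gamma) = 2 - 2 g]. *)
Definition genus (m : nat) (eps : cmap m) : rat :=
  (2 - ((ncycles (beta eps))%:R - (ncycles (alpha eps))%:R
        + (ncycles (gamma eps))%:R)) / 2.

Lemma genusE (m : nat) (eps : cmap m) :
  (ncycles (beta eps))%:R - (ncycles (alpha eps))%:R
    + (ncycles (gamma eps))%:R = 2 - 2 * genus eps.
Proof. by rewrite /genus mulrC divfK // subKr. Qed.

(* [nu \in porbits b'] says that [b'] restricts to a single cycle on [nu]. *)
Definition is_reembedding (m : nat) (nu : {set 'I_(2 * m)})
    (b b' : {perm 'I_(2 * m)}) : Prop :=
  (forall x, x \notin nu -> b' x = b x) /\ nu \in porbits b'.

Definition with_beta (m : nat) (eps : cmap m) (b : {perm 'I_(2 * m)}) : cmap m :=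
  @Cmap m (alpha eps) b (perm_comp (alpha eps) b) (alpha_edges eps) erefl.

(* Main.v *)
(** Multiplying [beta] by a permutation [sigma] supported on [nu] multiplies
    [gamma = alpha beta] by the same [sigma], so it suffices to find
    [sigma <> 1] keeping both [beta] on [nu] and [gamma] cyclic.  Take four
    consecutive half-edges [a, b, c, d] of [beta] at [nu].  If [gamma], read
    from [a] on, visits two of [b, c, d] in the same order as [beta], let
    [sigma] be the 3-cycle moving each of [a] and these two to the next one:
    both first-return maps become squares of 3-cycles.  Otherwise [gamma]
    visits [a, d, c, b] in this order, and [sigma = (a c)(b d)] is the square
    of both first-return 4-cycles, which become their own cubes. *)
Require Import Defs.
From HB Require Import structures.
From mathcomp Require Import all_boot all_order all_algebra all_fingroup zify.

Set Implicit Arguments.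
Unset Strict Implicit.
Unset Printing Implicit Defensive.

Import GroupScope.

Section PermOrbits.
Variable T : finType.
Implicit Types (s t u : {perm T}) (a b c d w x y : T) (A : {set T}).

(** * Orbits of a product [u * s], and first returns to the support of [u] *)

Lemma porbit_permM s a x : x \in porbit s a -> s x \in porbit s a.
Proof.
case/porbitP=> i ->; apply/porbitP; exists i.+1.
by rewrite expgSr permM.
Qed.

Lemma porbit_trans s x y a :
  x \in porbit s a -> y \in porbit s x -> y \in porbit s a.
Proof. by rewrite -eq_porbit_mem => /eqP <-. Qed.

Lemma porbit_stable s A a :
  a \in A -> (forall x, x \in A -> s x \in A) -> porbit s a \subset A.
Proof.
move=> aA sA; apply/subsetP=> x /porbitP[i ->{x}].
elim: i => [|i IHi]; first by rewrite expg0 perm1.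
by rewrite expgSr permM sA.
Qed.

Lemma porbit_expg_lt s a x :
  x \in porbit s a -> exists2 i, i < #|porbit s a| & x = (s ^+ i) a.
Proof.
rewrite porbit_traject => /trajectP[i ltiN ->]; exists i => //.
by rewrite permX.
Qed.

Lemma expg_perm_inj s a i j :
  i < #|porbit s a| -> j < #|porbit s a| ->
  (s ^+ i) a = (s ^+ j) a -> i = j.
Proof.
move=> ltiN ltjN; rewrite !permX => eq_ij; apply/eqP.
rewrite -(nth_uniq a _ _ (uniq_traject_porbit s a)) ?size_traject //.
by rewrite !nth_traject // eq_ij.
Qed.

(** Each orbit is stable under the other permutation: off [A] the permutation [u] changes nothing,
    and a point moved by [u] stays in [A], which lies in both orbits. *)
Lemma porbit_mulg u s A a :
  perm_on A u -> A \subset porbit s a -> a \in A ->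
  A \subset porbit (u * s) a -> porbit (u * s) a = porbit s a.
Proof.
move=> uA /subsetP sAs aA /subsetP sAus; apply/eqP; rewrite eqEsubset.
apply/andP; split; apply: porbit_stable; rewrite ?porbit_id // => x xO.
  rewrite permM porbit_permM //; have [xA | xNA] := boolP (x \in A).
    by rewrite sAs ?perm_closed.
  by rewrite (out_perm uA).
have -> : s x = (u * s) (u^-1 x) by rewrite permM permKV.
apply: porbit_permM; have [xA | xNA] := boolP (x \in A).
  by rewrite sAus // -(perm_closed _ uA) permKV.
by rewrite -{1}(out_perm uA xNA) permK.
Qed.

Lemma porbit_mulg_arc u s w x n :
  (forall i, 0 < i <= n -> u ((s ^+ i) x) = (s ^+ i) x) ->
  u w = x -> (s ^+ n.+1) x \in porbit (u * s) w.
Proof.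
move=> fix_arc uwx; elim: n fix_arc => [|n IHn] fix_arc.
  by rewrite expg1 -uwx -permM porbit_permM ?porbit_id.
rewrite expgSr permM -fix_arc ?leqnn // -permM porbit_permM // IHn //.
by move=> i /andP[i0 lein]; rewrite fix_arc // i0 leqW.
Qed.

(** After the jump from [w] to [(s ^+ p) a], the product [u * s] runs along [s] up to exponent [q],
    because [u] fixes every point strictly between. First returns to [A] are computed this way. *)
Lemma porbit_mulg_return u s A a p q w :
  perm_on A u -> p < q ->
  (forall r, p < r < q -> (s ^+ r) a \notin A) ->
  u w = (s ^+ p) a -> (s ^+ q) a \in porbit (u * s) w.
Proof.
move=> uA lt_pq outA uw; rewrite -(subnKC lt_pq) addSnnS expgD permM.
apply: porbit_mulg_arc => // i /andP[i0 lei].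
rewrite -(permM (s ^+ p)) -expgD (out_perm uA) // outA //.
by rewrite -addn1 leq_add2l i0 -(subnKC lt_pq) addSn ltnS leq_add2l.
Qed.

(** Cyclic order read from the base point [a]: strictly increasing exponents below the orbit length
    mean distinct points met within a single turn. *)
Definition cyc3 s a b c :=
  exists i j, [/\ 0 < i < j, j < #|porbit s a|, b = (s ^+ i) a
                & c = (s ^+ j) a].

Definition cyc4 s a b c d :=
  exists i j k, [/\ 0 < i < j, j < k < #|porbit s a|, b = (s ^+ i) a,
                    c = (s ^+ j) a & d = (s ^+ k) a].

Lemma cyc4_3 s a b c d :
  cyc4 s a b c d -> [/\ cyc3 s a b c, cyc3 s a b d & cyc3 s a c d].
Proof.
case=> i [j [k [/andP[i0 ij] /andP[jk kN] -> -> ->]]].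
split; [exists i, j | exists i, k | exists j, k].
- by rewrite i0 ij (ltn_trans jk).
- by rewrite i0 (ltn_trans ij jk).
- by rewrite jk (ltn_trans i0 ij).
Qed.

Lemma expg_card_porbit s a : (s ^+ #|porbit s a|) a = a.
Proof. by rewrite permX iter_porbit. Qed.

(** On the marked points, the first return of [u * s] is [u] followed by the successor in the cyclic
    order [a], [b], [c]. *)
Lemma cyc3_return s u a b c :
    cyc3 s a b c -> perm_on [set a; b; c] u ->
  [/\ forall w, u w = a -> b \in porbit (u * s) w,
      forall w, u w = b -> c \in porbit (u * s) w
    & forall w, u w = c -> a \in porbit (u * s) w].
Proof.
case=> i [j [/andP[i0 ij] jN Db Dc]] uA.
have eqX p q : p < #|porbit s a| -> q < #|porbit s a| ->
    ((s ^+ p) a == (s ^+ q) a) = (p == q).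
  by move=> pN qN; apply/eqP/eqP=> [/expg_perm_inj-> | ->].
have iN := ltn_trans ij jN; have N0 := ltn_trans i0 iN.
have Da : a = (s ^+ 0) a by rewrite expg0 perm1.
have outA r : r < #|porbit s a| -> r != 0%N -> r != i -> r != j ->
    (s ^+ r) a \notin [set a; b; c].
  move=> rN r0 ri rj.
  by rewrite !inE {2}Da Db Dc !eqX // (negPf r0) (negPf ri) (negPf rj).
split=> w uw.
- rewrite Db; apply: (porbit_mulg_return uA i0); last by rewrite -Da.
  by move=> r /andP[r0 ri]; apply: outA; lia.
- rewrite Dc; apply: (porbit_mulg_return uA ij); last by rewrite -Db.
  by move=> r /andP[r0 ri]; apply: outA; lia.
(* The last arc closes the turn: it ends at exponent [#|porbit s a|], where [s] is back at [a]. *)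
rewrite -{1}(expg_card_porbit s a).
apply: (porbit_mulg_return uA jN); last by rewrite -Dc.
by move=> r /andP[r0 ri]; apply: outA; lia.
Qed.

Lemma cyc4_return s u a b c d :
    cyc4 s a b c d -> perm_on [set a; b; c; d] u ->
  [/\ forall w, u w = a -> b \in porbit (u * s) w,
      forall w, u w = b -> c \in porbit (u * s) w,
      forall w, u w = c -> d \in porbit (u * s) w
    & forall w, u w = d -> a \in porbit (u * s) w].
Proof.
case=> i [j [k [/andP[i0 ij] /andP[jk kN] Db Dc Dd]]] uA.
have eqX p q : p < #|porbit s a| -> q < #|porbit s a| ->
    ((s ^+ p) a == (s ^+ q) a) = (p == q).
  by move=> pN qN; apply/eqP/eqP=> [/expg_perm_inj-> | ->].
have jN := ltn_trans jk kN.
have iN := ltn_trans ij jN; have N0 := ltn_trans i0 iN.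
have Da : a = (s ^+ 0) a by rewrite expg0 perm1.
have outA r : r < #|porbit s a| -> r != 0%N -> r != i -> r != j -> r != k ->
    (s ^+ r) a \notin [set a; b; c; d].
  move=> rN r0 ri rj rk; rewrite !inE {2}Da Db Dc Dd !eqX //.
  by rewrite (negPf r0) (negPf ri) (negPf rj) (negPf rk).
split=> w uw.
- rewrite Db; apply: (porbit_mulg_return uA i0); last by rewrite -Da.
  by move=> r /andP[r0 ri]; apply: outA; lia.
- rewrite Dc; apply: (porbit_mulg_return uA ij); last by rewrite -Db.
  by move=> r /andP[r0 ri]; apply: outA; lia.
- rewrite Dd; apply: (porbit_mulg_return uA jk); last by rewrite -Dc.
  by move=> r /andP[r0 ri]; apply: outA; lia.
rewrite -{1}(expg_card_porbit s a).
apply: (porbit_mulg_return uA kN); last by rewrite -Dd.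
by move=> r /andP[r0 ri]; apply: outA; lia.
Qed.

(** * The two modifications that keep an orbit whole *)

Definition shift3 a b c : {perm T} := tperm a b * tperm a c.

Definition swap22 a b c d : {perm T} := tperm a c * tperm b d.

Lemma shift3E a b c :
    uniq [:: a; b; c] ->
  [/\ shift3 a b c a = b, shift3 a b c b = c & shift3 a b c c = a].
Proof.
rewrite /= !inE negb_or andbT => /andP[/andP[ab ac] bc].
rewrite /shift3; split; rewrite permM.
- by rewrite tpermL tpermD // eq_sym.
- by rewrite tpermR tpermL.
by rewrite (tpermD ac bc) tpermR.
Qed.

Lemma swap22E a b c d :
    uniq [:: a; b; c; d] ->
  [/\ swap22 a b c d a = c, swap22 a b c d b = d, swap22 a b c d c = a
    & swap22 a b c d d = b].
Proof.
rewrite /= !inE !negb_or andbT => /and3P[/and3P[ab ac ad] /andP[bc bd] cd].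
rewrite /swap22; split; rewrite permM.
- by rewrite tpermL tpermD // eq_sym.
- by rewrite (tpermD ab) 1?eq_sym // tpermL.
- by rewrite tpermR tpermD // eq_sym.
by rewrite (tpermD ad cd) tpermR.
Qed.

(** Lets one permutation serve both the order [a, b, c, d] and its reverse [a, d, c, b]. *)
Lemma swap22_rev a b c d : swap22 a d c b = swap22 a b c d.
Proof. by rewrite /swap22 [tperm d b]tpermC. Qed.

Lemma perm_on_shift3 a b c : perm_on [set a; b; c] (shift3 a b c).
Proof.
apply/subsetP=> x; apply: contraR; rewrite !inE !negb_or -!andbA.
case/and3P=> xa xb xc.
by rewrite permM !tpermD // eq_sym.
Qed.

Lemma perm_on_swap22 a b c d : perm_on [set a; b; c; d] (swap22 a b c d).
Proof.
apply/subsetP=> x; apply: contraR; rewrite !inE !negb_or -!andbA.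
case/and4P=> xa xb xc xd.
by rewrite permM !tpermD // eq_sym.
Qed.

(** The first returns run [a -> c -> b], so the three points still share an orbit. *)
Lemma porbit_shift3 s a b c :
  uniq [:: a; b; c] -> cyc3 s a b c ->
  porbit (shift3 a b c * s) a = porbit s a.
Proof.
move=> Uabc s3; have [ua ub uc] := shift3E Uabc.
have uA := perm_on_shift3 a b c; have [rb rc _] := cyc3_return s3 uA.
have cO := rc a ua; have bO := porbit_trans cO (rb c uc).
apply: (porbit_mulg uA); first 1 last.
- by rewrite !inE eqxx.
- by apply/subsetP=> x; rewrite !inE => /orP[/orP[]|] /eqP-> //; apply: porbit_id.
case: s3 => i [j [_ _ Db Dc]].
apply/subsetP=> x; rewrite !inE => /orP[/orP[]|] /eqP->.
- exact: porbit_id.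
- by rewrite Db mem_porbit.
by rewrite Dc mem_porbit.
Qed.

(** The first returns run [a -> d -> c -> b], so the four points still share an orbit. *)
Lemma porbit_swap22 s a b c d :
  uniq [:: a; b; c; d] -> cyc4 s a b c d ->
  porbit (swap22 a b c d * s) a = porbit s a.
Proof.
move=> Uabcd s4; have [ua ub uc ud] := swap22E Uabcd.
have uA := perm_on_swap22 a b c d; have [rb rc rd _] := cyc4_return s4 uA.
have dO := rd a ua; have cO := porbit_trans dO (rc d ud).
have bO := porbit_trans cO (rb c uc).
apply: (porbit_mulg uA); first 1 last.
- by rewrite !inE eqxx.
- apply/subsetP=> x; rewrite !inE => /orP[/orP[/orP[]|]|] /eqP-> //.
  exact: porbit_id.
case: s4 => i [j [k [_ _ Db Dc Dd]]].
apply/subsetP=> x; rewrite !inE => /orP[/orP[/orP[]|]|] /eqP->.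
- exact: porbit_id.
- by rewrite Db mem_porbit.
- by rewrite Dc mem_porbit.
by rewrite Dd mem_porbit.
Qed.

(** Compare the exponents [i], [j], [k] of [b], [c], [d]: if no two of them increase, then
    [k < j < i]. *)
Lemma cyc4_cases t a b c d :
    b \in porbit t a -> c \in porbit t a -> d \in porbit t a ->
    uniq [:: a; b; c; d] ->
  [\/ cyc3 t a b c, cyc3 t a b d, cyc3 t a c d | cyc4 t a d c b].
Proof.
move=> /porbit_expg_lt[i iN ->] /porbit_expg_lt[j jN ->].
case/porbit_expg_lt=> k kN ->.
rewrite /= !inE !negb_or andbT => /and3P[/and3P[ai aj ak] /andP[ij ik] jk].
have nz p : a != (t ^+ p) a -> 0 < p.
  by rewrite lt0n; apply: contraNneq => ->; rewrite expg0 perm1.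
have i0 := nz i ai; have j0 := nz j aj; have k0 := nz k ak.
have [lt_ij | lt_ji | eq_ij] := ltngtP i j; last by rewrite eq_ij eqxx in ij.
  by constructor 1; exists i, j; rewrite i0 lt_ij.
have [lt_ik | lt_ki | eq_ik] := ltngtP i k; last by rewrite eq_ik eqxx in ik.
  by constructor 2; exists i, k; rewrite i0 lt_ik.
have [lt_jk | lt_kj | eq_jk] := ltngtP j k; last by rewrite eq_jk eqxx in jk.
  by constructor 3; exists j, k; rewrite j0 lt_jk.
by constructor 4; exists k, j, i; rewrite k0 lt_kj lt_ji.
Qed.

(** To be applied with [beta] as [s] and [gamma] as [t]; [u a != a] then makes the reembedding
    differ from [beta]. *)
Lemma reroute_common_cycle s t a :
    4 <= #|porbit s a| -> porbit s a \subset porbit t a ->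
  exists u : {perm T},
    [/\ perm_on (porbit s a) u, u a != a, porbit (u * s) a = porbit s a
      & porbit (u * t) a = porbit t a].
Proof.
move=> N4 /subsetP sub_st.
set b := (s ^+ 1) a; set c := (s ^+ 2) a; set d := (s ^+ 3) a.
have bO : b \in porbit s a by apply: mem_porbit.
have cO : c \in porbit s a by apply: mem_porbit.
have dO : d \in porbit s a by apply: mem_porbit.
have Uabcd : uniq [:: a; b; c; d].
  (* By [N4], these four points begin the duplicate-free list of the orbit. *)
  have := take_uniq 4 (uniq_traject_porbit s a).
  rewrite take_traject // => U4; congr uniq: U4.
  by rewrite /b /c /d !permX.
have s4 : cyc4 s a b c d by exists 1%N, 2, 3.
have [s3bc s3bd s3cd] := cyc4_3 s4.
have onO (A : {set T}) u : perm_on A u -> A \subset porbit s a ->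
    perm_on (porbit s a) u.
  by move=> uA; apply: subset_trans.
(* The 3-cycle argument, shared by the three possible pairs among [b], [c], [d]. *)
have shift x y : x \in porbit s a -> y \in porbit s a -> uniq [:: a; x; y] ->
    cyc3 s a x y -> cyc3 t a x y ->
  exists u : {perm T},
    [/\ perm_on (porbit s a) u, u a != a, porbit (u * s) a = porbit s a
      & porbit (u * t) a = porbit t a].
  move=> xO yO Uaxy s3 t3; exists (shift3 a x y).
  split; rewrite ?porbit_shift3 //.
    apply: onO (perm_on_shift3 a x y) _.
    apply/subsetP=> z; rewrite !inE => /orP[/orP[]|] /eqP-> //.
    exact: porbit_id.
  have [-> _ _] := shift3E Uaxy.
  by move: Uaxy; rewrite /= inE negb_or eq_sym; case: (x == a).
have subU l : subseq l [:: a; b; c; d] -> uniq l.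
  by move=> sub_l; apply: subseq_uniq sub_l Uabcd.
case: (cyc4_cases (sub_st b bO) (sub_st c cO) (sub_st d dO) Uabcd)
  => [t3|t3|t3|t4].
- apply: (shift b c) => //; apply: subU.
  exact: (mask_subseq [:: true; true; true; false] [:: a; b; c; d]).
- apply: (shift b d) => //; apply: subU.
  exact: (mask_subseq [:: true; true; false; true] [:: a; b; c; d]).
- apply: (shift c d) => //; apply: subU.
  exact: (mask_subseq [:: true; false; true; true] [:: a; b; c; d]).
exists (swap22 a b c d); split.
- apply: onO (perm_on_swap22 a b c d) _.
  apply/subsetP=> z; rewrite !inE => /orP[/orP[/orP[]|]|] /eqP-> //.
  exact: porbit_id.
- have [-> _ _ _] := swap22E Uabcd.
  by apply: contraTneq Uabcd => ->; rewrite /= !inE eqxx orbT.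
- exact: porbit_swap22.
rewrite -swap22_rev porbit_swap22 //.
(* The list computes to [[:: a; d; c; b]], the distinctness required for the reversed order. *)
have: uniq (a :: rev [:: b; c; d]) by rewrite cons_uniq mem_rev rev_uniq.
by [].
Qed.

(** * From a single orbit to cycle counts and genus *)

Lemma porbits_eq s t a :
    porbit t a = porbit s a -> (forall x, x \notin porbit s a -> t x = s x) ->
  porbits t = porbits s.
Proof.
move=> eq_a eq_out; apply: eq_imset => x.
have [xO | xNO] := boolP (x \in porbit s a).
  move: (xO); rewrite -eq_porbit_mem => /eqP->.
  by move: xO; rewrite -eq_a -eq_porbit_mem => /eqP->.
(* The [s]-orbit of [x] never meets that of [a], so [t] and [s] agree all along it. *)
have eqX i : (t ^+ i) x = (s ^+ i) x.
  elim: i => [|i IHi]; first by rewrite !expg0.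
  rewrite !expgSr !permM IHi eq_out //; apply: contraNN xNO => sixO.
  apply: porbit_trans sixO _.
  by rewrite porbit_sym mem_porbit.
by apply/setP=> y; apply/porbitP/porbitP=> -[i ->]; exists i; rewrite eqX.
Qed.

Lemma one_porbitP s a : reflect (porbit s a = [set: T]) (#|porbits s| == 1%N).
Proof.
apply: (iffP cards1P) => [[B sB] | aT].
  have inB x : porbit s x = B.
    by apply/set1P; rewrite -sB; apply: imset_f.
  by apply/setP=> x; rewrite inE (inB a) -(inB x) porbit_id.
exists [set: T]; apply/setP=> B; rewrite inE; apply/imsetP/eqP=> [[x _ ->] | ->].
  by rewrite -aT; apply/eqP; rewrite eq_porbit_mem aT inE.
by exists a.
Qed.

End PermOrbits.

Theorem theorem3p2 (m : nat) (G : graph m) (eps : cmap m)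
    (nu : {set 'I_(2 * m)}) :
  is_embedding eps G ->
  one_face eps ->
  nu \in vertices G ->
  4 <= deg nu ->
  exists b' : {perm 'I_(2 * m)},
    [/\ is_reembedding nu (beta eps) b',
        b' <> beta eps,
        is_embedding (with_beta eps b') G
      & genus (with_beta eps b') = genus eps].
Proof.
case=> eq_alpha vertE face1; rewrite -vertE => /imsetP[a _ ->{nu}] deg4.
have faceT := one_porbitP _ a (introT eqP face1).
(* The single face contains all half-edges, in particular those of the vertex. *)
have sub_face : porbit (beta eps) a \subset porbit (gamma eps) a.
  by rewrite faceT subsetT.
have [u [uO ua_neq ubO ugO]] := reroute_common_cycle deg4 sub_face.
have out x : x \notin porbit (beta eps) a -> (u * beta eps) x = beta eps x.
  by move=> xNO; rewrite permM (out_perm uO).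
have verts := porbits_eq ubO out.
exists (u * beta eps); split.
- by split=> //; rewrite -{1}ubO; apply: imset_f.
- move/permP/(_ a); rewrite permM => /perm_inj ua.
  by rewrite ua eqxx in ua_neq.
- by split; rewrite //= verts.
have face1' : ncycles (gamma (with_beta eps (u * beta eps))) = 1%N.
  apply/eqP/(one_porbitP _ a).
  (* In left-to-right products the new face permutation is [u * beta eps * alpha eps], which
     reassociates to [u * gamma eps]. *)
  by rewrite /= /perm_comp -mulgA -[beta eps * _](gammaE eps) ugO.
by rewrite /genus face1' face1 /ncycles /= verts.
Qed.
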